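(* Let $\alpha>0$, $\theta\in\mathbb{R}$ and $-\infty<\beta<1$, and let $\Gamma_{\alpha,\theta}=\{n^\alpha e^{2\pi n\theta\sqrt{-1}} \mid n\in\mathbb{Z}_{\ge 0}\}\subset\mathbb{C}$. If $\Gamma_{\alpha,\theta}$ is asymptotically $\beta$-uniformly discrete, then $1+2\alpha\beta\le 2\alpha$.
   Context: For a point set $\Gamma\subset\mathbb{C}$ put $\Gamma'=\{\gamma\in\Gamma \mid |\gamma|\ge 1\}$. For $-\infty<\beta<1$, a locally finite set $\Gamma$ (i.e. $\#\{\zeta\in\Gamma \mid |\zeta|<r\}<\infty$ for every $r>0$) is called asymptotically $\beta$-uniformly discrete if there exists $s>0$ satisfying one (equivalently, all) of the following three conditions, which are mutually equivalent for each fixed $s$: (i) for any $0<s_1<s$ there exists $M_1>0$ such that for any $z\in\mathbb{C}$ with $|z|\ge M_1$, $\#\{\zeta\in\Gamma' \mid |z-\zeta|<s_1|z|^\beta\}\le 1$; (ii) for any $0<s_2<s$ there exists $M_2>0$ such that for any $z\in\mathbb{C}$ with $|z|\ge M_2$, $\#\{\zeta\in\Gamma' \mid |z-\zeta|<s_2|\zeta|^\beta\}\le 1$; (iii) for any $0<s_3<s$ there exists $M_3>0$ such that for any $z\in\mathbb{C}$ with $|z|\ge M_3$, $\#\{\zeta\in\Gamma' \mid |z-\zeta|<\frac{s_3}{2}(|z|^\beta+|\zeta|^\beta)\}\le 1$. *)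

(* Defs.v *)
From HB Require Import structures.
From mathcomp Require Import all_boot all_order all_algebra.
From mathcomp Require Import complex.
From mathcomp Require Import all_classical all_reals all_analysis.

Set Implicit Arguments.
Unset Strict Implicit.
Unset Printing Implicit Defensive.

Import Order.TTheory GRing.Theory Num.Theory.

Local Open Scope classical_set_scope.
Local Open Scope card_scope.
Local Open Scope ring_scope.

(* The modulus on R[i], with values in R; the norm `|z| has values in R[i]. *)
Definition cmod (R : realType) (z : R[i]) : R := ComplexField.Normc.normc z.

Definition cis (R : realType) (t : R) : R[i] := Complex (cos t) (sin t).

Definition locally_finite (R : realType) (G : set R[i]) : Prop :=
  forall r : R, 0 < r -> finite_set [set z | G z /\ cmod z < r].

Definition outer (R : realType) (G : set R[i]) : set R[i] :=
  [set z | G z /\ 1 <= cmod z].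

Definition unif_discrete_center (R : realType) (beta s : R) (G : set R[i]) :
    Prop :=
  forall s1 : R, 0 < s1 < s -> exists2 M1 : R, 0 < M1 &
    forall z : R[i], M1 <= cmod z ->
      [set w | outer G w /\ cmod (z - w) < s1 * cmod z `^ beta] #<= `I_1.

Definition unif_discrete_point (R : realType) (beta s : R) (G : set R[i]) :
    Prop :=
  forall s2 : R, 0 < s2 < s -> exists2 M2 : R, 0 < M2 &
    forall z : R[i], M2 <= cmod z ->
      [set w | outer G w /\ cmod (z - w) < s2 * cmod w `^ beta] #<= `I_1.

Definition unif_discrete_mean (R : realType) (beta s : R) (G : set R[i]) :
    Prop :=
  forall s3 : R, 0 < s3 < s -> exists2 M3 : R, 0 < M3 &
    forall z : R[i], M3 <= cmod z ->
      [set w | outer G w /\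
        cmod (z - w) < s3 / 2 * (cmod z `^ beta + cmod w `^ beta)] #<= `I_1.

(* For beta < 1 the three conditions are equivalent for each fixed s, so
   requiring any one of them is the same notion; the disjunction does not
   privilege one of them. *)
Definition asymp_unif_discrete (R : realType) (beta : R) (G : set R[i]) :
    Prop :=
  locally_finite G /\
  exists2 s : R, 0 < s &
    [\/ unif_discrete_center beta s G, unif_discrete_point beta s G
      | unif_discrete_mean beta s G].

(* For n = 0 the point is 0 when alpha > 0, since powR 0 alpha = 0 then. *)
Definition spiral (R : realType) (alpha theta : R) : set R[i] :=
  [set ((n%:R `^ alpha)%:C * cis (2 * pi * n%:R * theta))%C
    | n in [set: nat]].

(* Main.v *)
Require Import Defs.
From HB Require Import structures.
From mathcomp Require Import all_boot all_order all_algebra.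
From mathcomp Require Import complex.
From mathcomp Require Import all_classical all_reals all_analysis.
From mathcomp Require Import ring lra.

Import Order.TTheory GRing.Theory Num.Theory.

Local Open Scope ring_scope.

(** Comparing areas gives the inequality.  The [N] points of the spiral with
    [N <= n < 2 * N] lie in the square of half-side [(2 * N) `^ alpha].  Their
    moduli all have order [N `^ alpha], so uniform discreteness keeps them at
    mutual distance at least a constant times [N `^ (alpha * beta)]
    ([asymp_unif_discrete_separated] and [powR_dyadic]).  Cutting the square
    into cells of that size, with at most one point per cell
    ([square_packing]), shows that [N] is at most a constant times
    [N `^ (2 * alpha * (1 - beta))].  Letting [N] grow forces
    [1 <= 2 * alpha * (1 - beta)]. *)

Lemma cmod_Re_le (R : realType) (z : R[i]) : `|complex.Re z| <= cmod z.
Proof.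
by case: z => x y; rewrite /cmod /= -sqrtr_sqr ler_wsqrtr // lerDl sqr_ge0.
Qed.

Lemma cmod_Im_le (R : realType) (z : R[i]) : `|complex.Im z| <= cmod z.
Proof.
by case: z => x y; rewrite /cmod /= -sqrtr_sqr ler_wsqrtr // lerDr sqr_ge0.
Qed.

Lemma cmod_lt_double (R : realType) (d : R) (z : R[i]) :
  `|complex.Re z| < d -> `|complex.Im z| < d -> cmod z < 2 * d.
Proof.
case: z => x y /= hx hy; have d0 : 0 < d := le_lt_trans (normr_ge0 x) hx.
rewrite /cmod /= -[ltRHS]ger0_norm; last lra.
rewrite -sqrtr_sqr ltr_sqrt; last by rewrite exprn_gt0 // mulr_gt0.
by move: hx hy; rewrite !ltr_norml => /andP[? ?] /andP[? ?]; nra.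
Qed.

Lemma truncn_eq_dist_lt1 (R : realType) (x y : R) :
  0 <= x -> 0 <= y -> Num.truncn x = Num.truncn y -> `|x - y| < 1.
Proof.
move=> /truncn_itv hx /truncn_itv hy exy; rewrite exy in hx.
by move: hx hy; rewrite ltr_norml -natr1 => /andP[? ?] /andP[? ?]; lra.
Qed.

(** All the points lie in a square of side [2 * A].  Cut it into [K.+1 ^ 2]
    cells of side [d], where [K] is the integer part of [2 * A / d]: two points
    of one cell would be less than [2 * d] apart, so the map from points to
    cells is injective. *)
Lemma square_packing (R : realType) (N : nat) (A d : R) (w : 'I_N -> R[i]) :
  0 < d ->
  (forall i, cmod (w i) <= A) ->
  (forall i j, i != j -> 2 * d <= cmod (w i - w j)) ->
  N%:R <= (2 * A / d + 1) ^+ 2.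
Proof.
move=> d0 hA hsep.
case: N w hA hsep => [|N] w hA hsep; first by rewrite sqr_ge0.
have A0 : 0 <= A.
  exact: le_trans (normr_ge0 _) (le_trans (cmod_Re_le _ (w ord0)) (hA ord0)).
pose cell (x : R) : nat := Num.truncn ((x + A) / d).
pose K := Num.truncn (2 * A / d).
have shift0 x : `|x| <= A -> 0 <= (x + A) / d.
  by rewrite ler_norml => /andP[? ?]; rewrite divr_ge0 //; lra.
have cellK x : `|x| <= A -> (cell x < K.+1)%N.
  move=> /[dup] /shift0 x0; rewrite ler_norml => /andP[_ xA].
  by rewrite ltnS le_truncn // ler_pM2r ?invr_gt0 //; lra.
have cell_close x y :
    `|x| <= A -> `|y| <= A -> cell x = cell y -> `|x - y| < d.
  move=> /shift0 x0 /shift0 y0 /(truncn_eq_dist_lt1 _ _ _ x0 y0).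
  have -> : (x + A) / d - (y + A) / d = (x - y) / d by field; lra.
  by rewrite normrM normfV (gtr0_norm d0) ltr_pdivrMr // mul1r.
have hRe i : `|complex.Re (w i)| <= A := le_trans (cmod_Re_le _ (w i)) (hA i).
have hIm i : `|complex.Im (w i)| <= A := le_trans (cmod_Im_le _ (w i)) (hA i).
pose f i := (Ordinal (cellK _ (hRe i)), Ordinal (cellK _ (hIm i))).
have f_inj : injective f.
  move=> i j [/(cell_close _ _ (hRe i) (hRe j)) hre].
  move=> /(cell_close _ _ (hIm i) (hIm j)) him; apply/eqP/negPn/negP => nij.
  have := hsep _ _ nij; rewrite leNgt => /negP; apply.
  by apply: cmod_lt_double; move: hre him; case: (w i) (w j) => [? ?] [? ?].
have := leq_card f f_inj; rewrite card_prod !card_ord => hN.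
have KA : K%:R <= 2 * A / d by rewrite truncn_le divr_ge0 ?mulr_ge0 // ltW.
have : N.+1%:R <= (K.+1%:R : R) ^+ 2 by rewrite expr2 -natrM ler_nat.
move=> /le_trans; apply; rewrite -natr1 lerXn2r ?nnegrE //; last first.
  by rewrite lerD2r.
by rewrite addr_ge0 // divr_ge0 ?mulr_ge0 // ltW.
Qed.

Lemma card_le1_eq (T : Type) (A : set T) (x y : T) :
  (A #<= `I_1)%card -> A x -> A y -> x = y.
Proof.
move=> /pcard_leP/unsquash f Ax Ay; apply: (@inj _ _ _ f); rewrite ?inE //.
move: (@funS _ _ _ _ f _ Ax) (@funS _ _ _ _ f _ Ay) => /=.
by case: (f x) (f y) => [|?] [|?].
Qed.

(** In each of the three conditions take the point [w1] itself as the centre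
    [z]: the set then contains [w1], hence not [w2].  The minimum is a lower
    bound for the radius common to the three conditions. *)
Lemma asymp_unif_discrete_separated (R : realType) (beta : R) (G : set R[i]) :
  asymp_unif_discrete beta G ->
  exists c M : R, 0 < c /\ forall w1 w2 : R[i], outer G w1 -> outer G w2 ->
    M <= cmod w1 -> w1 <> w2 ->
    c * Num.min (cmod w1 `^ beta) (cmod w2 `^ beta) <= cmod (w1 - w2).
Proof.
move=> [_ [s s0 hs]].
have s2 : 0 < s / 2 < s by apply/andP; split; lra.
have cmod_gt0 w : outer G w -> 0 < cmod w `^ beta.
  by case=> _ w1; rewrite powR_gt0 // (lt_le_trans ltr01).
have cmod_self (w : R[i]) : cmod (w - w) = 0.
  by rewrite subrr /cmod ComplexField.Normc.normc0.
case: hs => /(_ _ s2)[M _ hM]; exists (s / 2), M; (split; first lra);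
  move=> w1 w2 o1 o2 Mw1 w12; rewrite leNgt; apply/negP => close;
  apply: w12; apply: (card_le1_eq _ _ _ _ (hM w1 Mw1)); split => //;
  have := cmod_gt0 _ o1; have := cmod_gt0 _ o2; rewrite ?cmod_self.
- by move=> _ h; rewrite mulr_gt0 //; lra.
- by move=> _ _; rewrite (lt_le_trans close) // ler_pM2l ?ge_min ?lexx //; lra.
- by move=> _ h; rewrite mulr_gt0 //; lra.
- move=> _ _; rewrite (lt_le_trans close) // ler_pM2l ?ge_min ?lexx ?orbT //.
  by lra.
- by move=> h1 h2; rewrite mulr_gt0 //; lra.
- move=> h1 h2; rewrite (lt_le_trans close) //.
  have : Num.min (cmod w1 `^ beta) (cmod w2 `^ beta) <= cmod w1 `^ beta.
    by rewrite ge_min lexx.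
  have : Num.min (cmod w1 `^ beta) (cmod w2 `^ beta) <= cmod w2 `^ beta.
    by rewrite ge_min lexx orbT.
  by nra.
Qed.

Lemma powR_ge1 (R : realType) (x r : R) : 1 <= x -> 0 <= r -> 1 <= x `^ r.
Proof. by move=> x1 r0; rewrite -(powRr0 x) ler_powR. Qed.

(** The constant covers both signs of the exponent: the minimum of [x `^ r]
    on the interval is at [a] when [0 <= r], and at [2 * a] otherwise. *)
Lemma powR_dyadic (R : realType) (r a x : R) :
  0 < a -> a <= x <= 2 * a -> Num.min 1 (2 `^ r) * a `^ r <= x `^ r.
Proof.
move=> a0 /andP[ax xa]; have x0 : 0 < x := lt_le_trans a0 ax.
have ar : 0 <= a `^ r := powR_ge0 a r.
have [r0|r0] := leP 0 r.
  apply: (@le_trans _ _ (1 * a `^ r)).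
    by rewrite ler_wpM2r // ge_min lexx.
  by rewrite mul1r ge0_ler_powR // nnegrE ltW.
apply: (@le_trans _ _ (2 `^ r * a `^ r)).
  by rewrite ler_wpM2r // ge_min lexx orbT.
rewrite -powRM //; last exact: ltW.
rewrite -[r]opprK !(powRN _ (- r)).
rewrite lef_pV2 ?posrE ?powR_gt0 ?mulr_gt0 //.
by rewrite ge0_ler_powR ?nnegrE ?oppr_ge0 // ltW // mulr_gt0.
Qed.

Lemma cmod_polar (R : realType) (r t : R) :
  0 <= r -> cmod (r%:C * cis t)%C = r.
Proof.
move=> r0; rewrite /cmod ComplexField.Normc.normcM /= cos2Dsin2 expr0n addr0.
by rewrite sqrtr1 mulr1 sqrtr_sqr ger0_norm.
Qed.

Theorem lemma2 (R : realType) (alpha theta beta : R)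
  (halpha : 0 < alpha) (hbeta : beta < 1)
  (hG : asymp_unif_discrete beta (spiral alpha theta)) :
  1 + 2 * alpha * beta <= 2 * alpha.
Proof.
rewrite leNgt; apply/negP => hlt.
have [c [M [c0 hsep]]] := asymp_unif_discrete_separated _ _ _ hG.
pose kappa : R := Num.min 1 (2 `^ (alpha * beta)).
have kappa0 : 0 < kappa by rewrite lt_min ltr01 powR_gt0.
pose eps : R := 1 - 2 * (alpha - alpha * beta).
have eps0 : 0 < eps by rewrite /eps; lra.
(* [D * N `^ (alpha - alpha * beta)] is the ratio between the side
   [2 * (2 * N) `^ alpha] of the square and the side [d] of a cell. *)
pose D : R := 4 * 2 `^ alpha / (c * kappa).
have D0 : 0 < D.
  by rewrite /D divr_gt0 ?mulr_gt0 ?powR_gt0.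
(* [N] is so large that the points from [N] on have modulus at least [M], and
   that [N `^ eps] exceeds the bound [(D + 1) ^+ 2] given by the packing. *)
pose B : R := (D + 1) ^+ 2.
have [N N_gt0 hN] : exists2 N, (0 < N)%N &
    B `^ eps^-1 + `|M| `^ alpha^-1 < N%:R.
  exists (Num.truncn (B `^ eps^-1 + `|M| `^ alpha^-1)).+1 => //.
  by rewrite -truncn_le_nat.
have N0 : 0 < N%:R :> R by rewrite ltr0n.
have root_lt (b e : R) : 0 < e -> 0 <= b -> b `^ e^-1 < N%:R -> b < N%:R `^ e.
  move=> e0 b0 bN.
  have <- : (b `^ e^-1) `^ e = b by rewrite -powRrM mulVf ?lt0r_neq0 ?powRr1.
  by rewrite gt0_ltr_powR ?nnegrE ?powR_ge0.
have NB : B < N%:R `^ eps.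
  apply: root_lt => //; first by rewrite sqr_ge0.
  by rewrite (le_lt_trans _ hN) // lerDl powR_ge0.
have NM : M <= N%:R `^ alpha.
  apply: (le_trans (ler_norm M)); apply/ltW/root_lt => //.
  by rewrite (le_lt_trans _ hN) // lerDr powR_ge0.
pose w (i : 'I_N) : R[i] :=
  (((N + i)%:R `^ alpha)%:C * cis (2 * pi * (N + i)%:R * theta))%C.
have cmod_w i : cmod (w i) = (N + i)%:R `^ alpha.
  by rewrite cmod_polar // powR_ge0.
have Ni (i : 'I_N) :
    (N%:R <= (N + i)%:R :> R) && ((N + i)%:R <= 2 * N%:R :> R).
  by rewrite ler_nat leq_addr -natrM ler_nat mul2n -addnn leq_add2l ltnW.
have outer_w i : outer (spiral alpha theta) (w i).
  split; first by exists (N + i)%N.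
  by rewrite cmod_w powR_ge1 ?ler1n ?addn_gt0 ?N_gt0 // ltW.
have Mw i : M <= cmod (w i).
  have /andP[hNi _] := Ni i.
  by rewrite cmod_w (le_trans NM) // ge0_ler_powR ?nnegrE // ltW.
have w_inj : injective w.
  move=> i j /(congr1 (@cmod R)); rewrite !cmod_w.
  move=> /(congr1 (fun x => x `^ alpha^-1)).
  rewrite -!powRrM mulfV ?lt0r_neq0 // !powRr1 //.
  by move=> /eqP; rewrite eqr_nat eqn_add2l => /eqP /val_inj.
pose d : R := c * kappa * N%:R `^ (alpha * beta) / 2.
have d0 : 0 < d by rewrite /d divr_gt0 ?mulr_gt0 ?powR_gt0.
have w_sep i j : i != j -> 2 * d <= cmod (w i - w j).
  move=> /eqP nij; have wij : w i <> w j by move/w_inj.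
  apply: le_trans (hsep _ _ (outer_w i) (outer_w j) (Mw i) wij).
  have -> : 2 * d = c * (kappa * N%:R `^ (alpha * beta)) by rewrite /d; field.
  rewrite ler_pM2l // le_min !cmod_w -!powRrM.
  by rewrite !powR_dyadic.
have w_le i : cmod (w i) <= (2 * N%:R) `^ alpha.
  have /andP[_ iN] := Ni i.
  by rewrite cmod_w ge0_ler_powR ?nnegrE ?mulr_ge0 // ltW.
have := square_packing _ _ _ _ _ d0 w_le w_sep; apply/negP; rewrite -ltNge.
pose g : R := alpha - alpha * beta.
have -> : 2 * (2 * N%:R) `^ alpha / d = D * N%:R `^ g.
  have -> : (2 * N%:R) `^ alpha
      = 2 `^ alpha * (N%:R `^ g * N%:R `^ (alpha * beta)).
    rewrite -powRD ?subrK ?(gt_eqF N0) ?implybT // -powRM //.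
  rewrite /d /D; field.
  by rewrite !lt0r_neq0 ?powR_gt0.
(* As [beta < 1], the power [N `^ g] is at least 1 and absorbs the summand 1 of
   the packing bound. *)
have g0 : 0 < g by rewrite /g; nra.
have Ng1 : 1 <= N%:R `^ g.
  by rewrite powR_ge1 ?ler1n // ltW.
have NE : N%:R = N%:R `^ eps * (N%:R `^ g) ^+ 2.
  rewrite -powR_mulrn ?powR_ge0 // -powRrM -powRD ?(gt_eqF N0) ?implybT //.
  by rewrite /eps -/g mulrC [g * _]mulrC subrK powRr1 // ltW.
rewrite [ltRHS]NE; apply: (@le_lt_trans _ _ (B * (N%:R `^ g) ^+ 2)); last first.
  by rewrite ltr_pM2r // exprn_gt0 // powR_gt0.
rewrite /B -exprMn lerXn2r ?nnegrE //; nra.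
Qed.
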